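(* Let $m \ge 1$ and $N$ be positive integers. If $V_m(N)$ is not empty then it contains a unique optimal element, and this optimal element is the greedy element of $V_m(N)$.
   Context: Let $p$ be a prime, $s\ge 1$ an integer. For a positive integer $N$ and $m\ge 1$, $V_m(N)$ is the set of valid compositions of $N$ of length $m$: $m$-tuples $(X_1,\dots,X_m)$ of positive integers with $X_1+\dots+X_m=N$ such that (i) there is no carryover of $p$-adic digits in the sum $N=\sum X_j$ (for each $j\ge0$ the $j$-th base-$p$ digits of $X_1,\dots,X_m$ sum to the $j$-th base-$p$ digit of $N$), and (ii) $p^s-1$ divides $X_j$ for $1\le j\le m-1$. The weight of $X=(X_1,\dots,X_m)$ is $wt(X)=X_1+2X_2+\dots+mX_m$. An element $O$ of a finite set $W$ of $m$-tuples is optimal in $W$ if $wt(O)\ge wt(X)$ for all $X\in W$. The greedy element of $W$ is the tuple $(G_1,\dots,G_m)\in W$ for which $(G_m,G_{m-1},\dots,G_1)$ is lexicographically largest among all $(X_m,\dots,X_1)$, $X\in W$. *)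

(* Defs.v *)
From mathcomp Require Import all_boot all_order.

Set Implicit Arguments.
Unset Strict Implicit.
Unset Printing Implicit Defensive.

Definition digit (p j n : nat) : nat := (n %/ p ^ j) %% p.

(* A composition (X_1, ..., X_m) is encoded as X : m.-tuple nat, indexed from 0:
   X_j is [tnth X i] with i = j - 1. *)
Definition composition (m N : nat) (X : m.-tuple nat) : Prop :=
  (forall i : 'I_m, 0 < tnth X i) /\ \sum_(i < m) tnth X i = N.

Definition no_carry (p m N : nat) (X : m.-tuple nat) : Prop :=
  forall j : nat, \sum_(i < m) digit p j (tnth X i) = digit p j N.

(* The divisibility condition is not imposed on the last entry. *)
Definition valid (p s m N : nat) (X : m.-tuple nat) : Prop :=
  [/\ composition N X, no_carry p N X &
      forall i : 'I_m, i.+1 < m -> p ^ s - 1 %| tnth X i].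

Definition wt (m : nat) (X : m.-tuple nat) : nat :=
  \sum_(i < m) i.+1 * tnth X i.

Definition optimal (m : nat) (W : m.-tuple nat -> Prop) (O : m.-tuple nat) :
    Prop :=
  W O /\ forall X, W X -> wt X <= wt O.

(* [seqlexi nat] is [seq nat] with the lexicographic order; all the sequences
   compared here have the same length m. *)
Definition greedy (m : nat) (W : m.-tuple nat -> Prop) (G : m.-tuple nat) :
    Prop :=
  W G /\
  forall X, W X -> (Order.le (rev X : seqlexi nat) (rev G : seqlexi nat)).

(* Main.v *)
Require Import Defs.
From mathcomp Require Import all_boot all_order.
From mathcomp Require Import zify.
From Stdlib Require Import Classical.

(* A valid X amounts to the chain of its partial sums S_1 < ... < S_(m-1), and
   wt X + (S_1 + ... + S_(m-1)) = m N, so the sum of the S_j is minimised. View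
   N as a multiset of units p^h, the class of p^h being h mod s. A multiset of
   a_k units of class k (k in Z/s) is divisible by p^s - 1 exactly when
   a_k = p W_k - W_(k-1) for an integral vector W, which is positive when the
   multiset is nonempty. Relax the problem to chains of vectors
   W^1 < ... < W^(m-1), a vector W costing weight W, the sum of the a_k smallest
   units of each class k; weight is submodular for componentwise min and max.
   Let B minimise weight among the W >= t, where t = m - 1. Replacing W^t by B
   and W^(t-i) by min(W^(t-i), B - i) lowers the total: when d = max(W^t, B) - B
   is nonzero, let p^H be the largest unit acquired from B to B + d. Minimality
   of B forces every class giving up units to have only units below p^H in B,
   and on the layer B - i, where p - 1 units of each class are missing for each
   of the i steps, only units below p^(H - is); the base-p expansion of p^H - 1
   then shows that the losses never cancel the gain. Hence the greedy relaxed
   chain is optimal. It can be chosen nested, which makes it the chain of partial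
   sums of the greedy composition. *)

(** * Sums of the smallest units of a class *)

(** Where [d] is largest the hypothesis gives [p * d k <= d k], so the maximum is 0. *)
Lemma cyclic_contraction (s p : nat) (d : 'I_s -> nat) :
  1 < p -> (forall k, p * d k <= d (ord_pred k)) -> forall k, d k = 0.
Proof.
move=> p_gt1 d_pred k0.
case: (@arg_maxnP _ k0 predT d isT) => k _ d_max.
have := d_pred k; have := d_max (ord_pred k) isT; have := d_max k0 isT.
nia.
Qed.

Definition cost (p : nat) (l : seq nat) (a : nat) : nat :=
  \sum_(x <- take a l) p ^ x.

Definition mass_below (p : nat) (l : seq nat) (h : nat) : nat :=
  \sum_(x <- l | x < h) p ^ x.

(* The largest value of a number below p^h whose nonzero digits all have
   positions congruent to [i] modulo [s]. *)
Definition class_mass (p s i h : nat) : nat :=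
  \sum_(x < h | x %% s == i) p.-1 * p ^ x.

Lemma cost_addn (p : nat) (l : seq nat) (a d : nat) : a + d <= size l ->
  cost p l (a + d) = cost p l a + \sum_(i < d) p ^ nth 0 l (a + i).
Proof.
elim: d => [|d IHd] le_l; first by rewrite addn0 big_ord0 addn0.
rewrite /cost addnS (take_nth 0); last by lia.
rewrite -cats1 big_cat big_seq1 /= -/(cost p l (a + d)) IHd; last by lia.
by rewrite big_ord_recr /= addnA.
Qed.

Lemma cost_mono (p : nat) (l : seq nat) (a b : nat) :
  a <= b -> cost p l a <= cost p l b.
Proof.
move=> le_ab; rewrite /cost -(cat_take_drop a (take b l)) take_takel //.
by rewrite big_cat leq_addr.
Qed.

(** Discrete convexity: in a sorted list, the [b - a] units after position [c] are at least as large
    as those after position [a]. *)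
Lemma cost_exchange (p : nat) (l : seq nat) (a b c d : nat) :
    0 < p -> sorted leq l -> a <= b -> a <= c -> b + c <= a + d ->
  d <= size l -> cost p l b + cost p l c <= cost p l a + cost p l d.
Proof.
move=> p_gt0 l_sorted ab ac bcad dl.
apply: leq_trans (_ : cost p l a + cost p l (c + (b - a)) <= _); last first.
  by rewrite leq_add2l cost_mono //; lia.
rewrite -{1}(subnKC ab) !cost_addn; try lia.
rewrite -!addnA leq_add2l addnC leq_add2l leq_sum // => i _; have i_lt := ltn_ord i.
rewrite leq_pexp2l // (sorted_leq_nth leq_trans leqnn) ?inE //; lia.
Qed.

Lemma cost_le_mass_below (p : nat) (l : seq nat) (a h : nat) :
    (forall n, n < a -> n < size l -> nth 0 l n < h) ->
  cost p l a <= mass_below p l h.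
Proof.
move=> lt_h; rewrite /cost /mass_below.
apply: (@leq_trans (\sum_(x <- take a l | x < h) p ^ x)); last first.
  by rewrite -{2}(cat_take_drop a l) big_cat leq_addr.
rewrite big_seq [X in _ <= X]big_seq_cond; apply/eq_leq/eq_bigl => x.
apply/esym; apply: andb_idr => /(nthP 0)[n]; rewrite size_take_min => n_lt <-.
move: n_lt; rewrite ltn_min => /andP[n_lt n_size].
by rewrite nth_take // lt_h.
Qed.

Lemma class_mass_below (p s i h : nat) (l : seq nat) :
    (forall x, count_mem x l <= (x %% s == i) * p.-1) ->
  mass_below p l h <= class_mass p s i h.
Proof.
move=> l_count; elim: h => [|h IHh].
  by rewrite /mass_below big_pred0.
rewrite /class_mass big_mkcond big_ord_recr -big_mkcond /=.
rewrite -/(class_mass p s i h).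
rewrite /mass_below (bigID (fun x => x < h)) /= leq_add //.
  apply: leq_trans IHh; rewrite leq_eqVlt; apply/orP; left; apply/eqP.
  by apply: eq_bigl => x; lia.
rewrite (eq_bigl (pred1 h)); last by move=> x; rewrite /=; lia.
rewrite (eq_bigr (fun=> p ^ h)); last by move=> x /eqP->.
rewrite big_const_seq iter_addn_0 mulnC.
have := l_count h; case: ifP => _; last by lia.
by rewrite mul1n leq_mul2r orbC => ->.
Qed.

(** The base-[p] expansion of [p ^ h - 1] has all digits [p - 1]; here it is split by residue
    classes. *)
Lemma class_mass_total (p s h : nat) : 0 < p -> 0 < s ->
  (\sum_(i < s) class_mass p s i h).+1 = p ^ h.
Proof.
move=> p_gt0 s_gt0.
have -> : \sum_(i < s) class_mass p s i h = \sum_(x < h) p.-1 * p ^ x.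
  rewrite (eq_bigr _ (fun i _ => big_mkcond _ _)) exchange_big /=.
  apply: eq_bigr => x _; rewrite -big_mkcond /=.
  rewrite (big_pred1 (Ordinal (ltn_pmod x s_gt0))) //.
by rewrite -[RHS]prednK ?expn_gt0 ?p_gt0 // predn_exp big_distrr.
Qed.

(** A digit [p - 1] at position [h - i * s], in the class of [h], pays for the [i]-th term. Once
    [i * s] exceeds [h], the truncated exponent makes the term 0. *)
Lemma class_mass_shift (p s h n : nat) : 1 < p -> 0 < s ->
  \sum_(1 <= i < n.+1) (p ^ (h - i * s) - 1) <= class_mass p s (h %% s) h.
Proof.
move=> p_gt1 s_gt0; elim: n h => [|n IHn] h; first by rewrite big_nil.
case: (ltnP h s) => [lt_hs|le_sh].
  rewrite big1_seq // => i; rewrite mem_index_iota => i_ge1.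
  by rewrite (_ : h - i * s = 0) //; nia.
rewrite big_nat_recl // mul1n.
have step : p.-1 * p ^ (h - s) + class_mass p s ((h - s) %% s) (h - s) <=
    class_mass p s (h %% s) h.
  have eq_mod : (h - s) %% s = h %% s by rewrite -[in RHS](subnK le_sh) modnDr.
  rewrite /class_mass eq_mod -!(big_mkord (fun x => x %% s == h %% s)
    (fun x => p.-1 * p ^ x)).
  rewrite [X in _ <= X](@big_cat_nat _ _ _ (h - s)) ?leq_subr //= addnC leq_add2l.
  by rewrite big_ltn_cond ?eq_mod ?eqxx ?leq_addr // ltn_subrL s_gt0; lia.
apply: leq_trans step; apply: leq_add.
  have : 0 < p ^ (h - s) by rewrite expn_gt0; lia.
  nia.
apply: leq_trans (IHn (h - s)).
by apply: leq_sum => i _; rewrite mulSn subnDA.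
Qed.

(** An exponent occurs at most [p - 1] times, so it has changed [p - 1] positions later; all
    exponents being congruent modulo [s], it has grown by at least [s]. *)
Lemma nth_shift (p s i : nat) (l : seq nat) (n : nat) : 0 < p -> sorted leq l ->
    (forall x, count_mem x l <= (x %% s == i) * p.-1) ->
    n + p.-1 < size l ->
  nth 0 l n + s <= nth 0 l (n + p.-1).
Proof.
move=> p_gt0 l_sorted l_count n_lt.
have nth_mono a b : a <= b -> b < size l -> nth 0 l a <= nth 0 l b.
  by move=> ab bl; rewrite (sorted_leq_nth leq_trans leqnn) ?inE //; lia.
have nth_mod a : a < size l -> nth 0 l a %% s = i.
  move=> al; have := l_count (nth 0 l a); case: eqP => // _.
  by rewrite mul0n leqn0 => /eqP /count_memPn; rewrite mem_nth.
have := nth_mono n (n + p.-1) (leq_addr _ _) n_lt.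
rewrite leq_eqVlt => /orP[/eqP eq_n|lt_n].
  have : count_mem (nth 0 l n) (take p (drop n l)) <= p.-1.
    apply: leq_trans (_ : count_mem (nth 0 l n) l <= _).
      by rewrite leq_count_subseq // (subseq_trans (take_subseq _ _)) ?drop_subseq.
    by have := l_count (nth 0 l n); case: eqP; lia.
  have szp : size (take p (drop n l)) = p by rewrite size_takel // size_drop; lia.
  suff -> : count_mem (nth 0 l n) (take p (drop n l)) = p by lia.
  rewrite -[RHS]szp; apply/eqP; rewrite -all_count; apply/(all_nthP 0) => a.
  rewrite szp => a_lt; rewrite nth_take // nth_drop /= eqn_leq.
  by rewrite {1}eq_n !nth_mono; lia.
have n_lt' : n < size l by lia.
have := divn_eq (nth 0 l n) s; have := divn_eq (nth 0 l (n + p.-1)) s.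
rewrite (nth_mod _ n_lt) (nth_mod _ n_lt') => eq_b eq_a.
have lt_q : nth 0 l n %/ s < nth 0 l (n + p.-1) %/ s.
  by rewrite ltnNge; apply/negP => /(leq_mul (leqnn s)); lia.
by have := leq_mul (leqnn s) lt_q; lia.
Qed.

Lemma nth_shift_iter (p s i : nat) (l : seq nat) (n k : nat) :
    0 < p -> sorted leq l ->
    (forall x, count_mem x l <= (x %% s == i) * p.-1) ->
    n + k * p.-1 < size l ->
  nth 0 l n + k * s <= nth 0 l (n + k * p.-1).
Proof.
move=> p_gt0 l_sorted l_count; elim: k => [|k IHk] n_lt; first by rewrite !addn0.
have eq_n : n + k.+1 * p.-1 = n + k * p.-1 + p.-1 by lia.
have step : nth 0 l (n + k * p.-1) + s <= nth 0 l (n + k.+1 * p.-1).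
  by rewrite eq_n (nth_shift p s i) // -eq_n.
by have := IHk; lia.
Qed.

(** Used with [x = d k] and [y = d (prv k)]: the excess of [p * d k] over [d (prv k)] does not grow
    when [d] is rounded down to [d %/ z]. *)
Lemma divn_contraction (p x y z : nat) : 0 < z ->
  p * (x %/ z) <= y %/ z + (p * x - y).
Proof.
move=> z_gt0; apply: leq_trans (_ : (p * x) %/ z <= _).
  by rewrite leq_divRL // -mulnA leq_mul2l leq_divM orbT.
apply: leq_trans (_ : (y + (p * x - y) * z) %/ z <= _); last by rewrite divnDMl.
by apply: leq_div2r; nia.
Qed.

Lemma ex_minimal {T : Type} (P : T -> Prop) (f : T -> nat) :
  (exists x, P x) -> exists x, P x /\ forall y, P y -> f x <= f y.
Proof.
case=> x0; have [n] := ubnP (f x0); elim: n x0 => // n IHn x0 lt_n Px0.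
case: (classic (exists y, P y /\ f y < f x0)) => [[y [Py lt_y]]|no_y].
  by apply: (IHn y) => //; lia.
exists x0; split=> // y Py; rewrite leqNgt; apply/negP => lt_y.
by apply: no_y; exists y.
Qed.

Lemma lexi_nth (a b : seq nat) : size a = size b ->
    (forall i, i < size a -> (forall j, j < i -> nth 0 a j = nth 0 b j) ->
      nth 0 a i <= nth 0 b i) ->
  Order.le (a : seqlexi nat) (b : seqlexi nat).
Proof.
elim: a b => [|x a IHa] [|y b] //= [eq_size] le_nth.
rewrite Order.SeqLexiOrder.lexi_cons; apply/andP; split; first exact: (le_nth 0).
apply/implyP => le_yx; have eq_xy : x = y.
  by apply/eqP; rewrite eqn_leq (le_nth 0).
apply: IHa => // i lt_i eq_nth; apply: (le_nth i.+1) => // -[|j] // lt_j.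
exact: eq_nth.
Qed.

(** * Chains of vectors *)

Section Optimization.

(** In the application [lv k] lists in increasing order the exponents of the units of class [k] in
    [N], whose digits are at most [p - 1]. *)
Variables (p s : nat) (lv : 'I_s -> seq nat).
Hypothesis p_gt1 : 1 < p.
Hypothesis lv_sorted : forall k, sorted leq (lv k).
Hypothesis lv_count : forall k x, count_mem x (lv k) <= (x %% s == k) * p.-1.

Notation prv := (@ord_pred s).
Notation level := (nth 0).

Implicit Types (B U W Z d : 'I_s -> nat) (k : 'I_s).

Let p_gt0 : 0 < p. Proof. exact: ltnW. Qed.

Let s_gt0 k : 0 < s. Proof. exact: leq_ltn_trans (ltn_ord k). Qed.

(* Truncated at 0 when [W (prv k)] exceeds [p * W k]. *)
Definition demand W k : nat := p * W k - W (prv k).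

Definition weight W : nat := \sum_k cost p (lv k) (demand W k).

Definition admissible W : Prop :=
  forall k, p * W k <= W (prv k) + size (lv k).

Definition untruncated W : Prop := forall k, W (prv k) <= p * W k.

(** Chains are positive and grow by at least 1 in every coordinate at each step, so the bound [t]
    leaves room for [t - 1] vectors below. *)
Definition box (t : nat) U W : Prop :=
  admissible W /\ forall k, t <= W k <= U k.

Definition best (t : nat) U B : Prop :=
  box t U B /\ forall W, box t U W -> weight B <= weight W.

Lemma demand_le_size W k : admissible W -> demand W k <= size (lv k).
Proof. by move=> /(_ k); rewrite /demand; lia. Qed.

Lemma level_mod k n : n < size (lv k) -> level (lv k) n %% s = k.
Proof.
move=> n_lt; have := lv_count k (level (lv k) n); case: eqP => // _.
by rewrite mul0n leqn0 => /eqP /count_memPn; rewrite mem_nth.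
Qed.

Lemma level_mono k a b :
  a <= b -> b < size (lv k) -> level (lv k) a <= level (lv k) b.
Proof. by move=> ab bl; rewrite (sorted_leq_nth leq_trans leqnn) ?inE //; lia. Qed.

Lemma cost_le_class_mass k a h :
    (forall n, n < a -> n < size (lv k) -> level (lv k) n < h) ->
  cost p (lv k) a <= class_mass p s k h.
Proof.
move=> /(cost_le_mass_below p) /leq_trans; apply.
exact: class_mass_below.
Qed.

(** If one vector is the smaller both at [k] and at [prv k], the demands of class [k] are merely
    permuted. Otherwise those of meet and join lie between the two given ones, and [cost_exchange]
    applies. *)
Lemma weight_submodular W Z : admissible W -> admissible Z ->
  weight (fun k => minn (W k) (Z k)) + weight (fun k => maxn (W k) (Z k)) <=
  weight W + weight Z.
Proof.
move=> admW admZ; rewrite /weight -!big_split; apply: leq_sum => k _ /=.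
have := admW k; have := admZ k; rewrite /demand.
case: (leqP (W k) (Z k)) => le_k; case: (leqP (W (prv k)) (Z (prv k))) => le_prv.
- by move=> _ _.
- move=> hZ hW; have := leq_mul (leqnn p) le_k.
  by move=> le_pk; apply: cost_exchange => //; lia.
- move=> hZ hW; have := leq_mul (leqnn p) (ltnW le_k).
  by move=> le_pk; rewrite [X in _ <= X]addnC; apply: cost_exchange => //; lia.
- by move=> _ _; rewrite addnC.
Qed.

(** * Perturbations of a lightest vector *)

Section Perturbation.

Variables (t : nat) (U B d : 'I_s -> nat) (h : nat).
Hypothesis B_best : best t U B.
Hypothesis B_untr : untruncated B.
Hypothesis Bd_box : box t U (fun k => B k + d k).
Hypothesis h_top : forall k, let a := demand (fun k => B k + d k) k in
  demand B k < a -> level (lv k) a.-1 <= h.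

(* Otherwise [B + d %/ d (prv k)], which gives up one such unit and acquires
   only smaller ones, would be better than [B]. *)
Lemma high_level_frozen k : 0 < demand B k ->
  h <= level (lv k) (demand B k).-1 -> d (prv k) = 0.
Proof.
move=> a_gt0 h_le; apply/eqP; rewrite eqn0Ngt; apply/negP => z_gt0.
set z := d (prv k) in z_gt0 *; set a := demand B k in a_gt0 h_le.
set e := level (lv k) a.-1 in h_le.
have [admB B_ge] := B_best.1; have [admBd Bd_ge] := Bd_box.
have a_size : a <= size (lv k) by exact: demand_le_size.
(* With [p - 1] or more new units, class [k] would acquire an exponent of at least [e + s], beyond
   [h]. *)
have dk_le : p * d k <= z + (p - 2).
  rewrite leqNgt; apply/negP => dk_gt.
  have aE : a + p.-1 <= demand (fun k => B k + d k) k.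
    by move: dk_gt (B_untr k); rewrite /a /demand /z; lia.
  have le_size := demand_le_size _ k admBd.
  have := h_top k; rewrite /= => /(_ ltac:(rewrite -/a; lia)) le_h.
  have := nth_shift p s k (lv k) a.-1 p_gt0 (lv_sorted k) (lv_count k) ltac:(lia).
  have := level_mono k (a.-1 + p.-1) (demand (fun k => B k + d k) k).-1
    ltac:(lia) ltac:(lia).
  by have := s_gt0 k; rewrite -/e; lia.
have dk_lt : d k < z by nia.
(* The quotient is 0 at [k] and 1 at [prv k], so class [k] gives up exactly the unit [p ^ e]. *)
pose zeta j := d j %/ z.
have zeta_k : zeta k = 0 by rewrite /zeta divn_small.
have zeta_prv : zeta (prv k) = 1 by rewrite /zeta divnn z_gt0.
have zetaP j : p * zeta j <= zeta (prv j) + (p * d j - d (prv j)).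
  exact: divn_contraction.
have zeta_le j : zeta j <= d j by exact: leq_div.
pose Z j := B j + zeta j.
have Z_box : box t U Z.
  split=> j; last first.
    by have := B_ge j; have := Bd_ge j; have := zeta_le j; rewrite /Z; lia.
  by have := zetaP j; have := admB j; have := admBd j; rewrite /Z; lia.
have := B_best.2 Z Z_box; apply/negP; rewrite -ltnNge.
rewrite /weight (bigD1 k) //= [X in _ < X](bigD1 k) //=.
have -> : demand Z k = a.-1 by rewrite /demand /Z zeta_k zeta_prv /a /demand; lia.
have -> : cost p (lv k) a = cost p (lv k) a.-1 + p ^ e.
  by rewrite -{1}(prednK a_gt0) -addn1 cost_addn ?big_ord1 ?addn0 //; lia.
have mass_lt : \sum_(j < s | j != k) class_mass p s j e < p ^ e.
  rewrite -(class_mass_total p s e) ?(s_gt0 k) //.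
  by rewrite [X in _ < X.+1](bigD1 k) //= ltnS leq_addl.
(* A class that acquires units has only exponents up to [h], hence below [e], as [e] itself belongs
   to class [k]. Together such classes cost less than [p ^ e]. *)
rewrite -addnA ltn_add2l; apply: leq_ltn_trans (_ : \sum_(j < s | j != k)
  (class_mass p s j e + cost p (lv j) (demand B j)) < _).
  apply: leq_sum => j jk.
  case: (leqP (demand Z j) (demand B j)) => [le_dem|lt_dem].
    by apply: leq_trans (leq_addl _ _); exact: cost_mono.
  apply: leq_trans (leq_addr _ _); apply: cost_le_class_mass => n n_lt n_size.
  have le_dem : demand Z j <= demand (fun k => B k + d k) j.
    by move: lt_dem (zetaP j); rewrite /demand /Z; lia.
  have le_size := demand_le_size _ j admBd.
  have := h_top j; rewrite /= => /(_ ltac:(lia)) le_h.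
  have le_n : level (lv j) n <= e.
    apply: leq_trans h_le; apply: leq_trans le_h.
    by apply: level_mono; lia.
  rewrite ltn_neqAle le_n andbT; apply: contra_neq jk => eq_e; apply: val_inj.
  rewrite /= -(level_mod j n n_size) eq_e level_mod //; lia.
by rewrite big_split /= ltn_add2r.
Qed.

(** Class [k] can give up units only if [eta (prv k)], hence [d (prv k)], is positive. Then
    [high_level_frozen] puts its units in [B] below exponent [h], and dropping the last
    [i * (p - 1)] of them lowers this bound by [i * s]. *)
Lemma cost_shift (i : nat) (eta : 'I_s -> nat) k :
    (forall j, i <= B j) -> (forall j, eta j <= d j) ->
  cost p (lv k) (demand (fun j => B j - i) k) <=
  cost p (lv k) (demand (fun j => B j - i + eta j) k) +
  class_mass p s k (h - i * s).
Proof.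
move=> le_iB eta_le; have i_k := le_iB k; have i_prv := le_iB (prv k).
case: (posnP (eta (prv k))) => [eta0|eta_gt0].
  apply: leq_trans (leq_addr _ _); apply: cost_mono.
  by rewrite /demand eta0; nia.
apply: leq_trans (leq_addl _ _); apply: cost_le_class_mass => n n_lt n_size.
have demE : demand (fun j => B j - i) k = demand B k - i * p.-1.
  have eq_p : i * p.-1 + i = p * i by rewrite -mulnSr prednK // mulnC.
  have := leq_mul (leqnn p) i_k; have := B_untr k.
  by rewrite /demand mulnBr; lia.
have a_gt0 : 0 < demand B k by lia.
have a_size := demand_le_size _ k B_best.1.1.
have lt_h : level (lv k) (demand B k).-1 < h.
  rewrite ltnNge; apply/negP => /(high_level_frozen k a_gt0) d0.
  by have := eta_le (prv k); lia.
have := nth_shift_iter p s k (lv k) n i p_gt0 (lv_sorted k) (lv_count k) ltac:(lia).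
have := level_mono k (n + i * p.-1) (demand B k).-1 ltac:(lia) ltac:(lia).
lia.
Qed.

Lemma weight_shift (i : nat) (eta : 'I_s -> nat) :
    (forall j, i <= B j) -> (forall j, eta j <= d j) -> 0 < s ->
  weight (fun j => B j - i) <=
  weight (fun j => B j - i + eta j) + (p ^ (h - i * s) - 1).
Proof.
move=> le_iB eta_le s_pos.
rewrite -(class_mass_total p s) // subn1 -/predn /= /weight -big_split.
by apply: leq_sum => k _; exact: cost_shift.
Qed.

(** The other classes lose at most their masses below [h]. What is left of the acquired [p ^ h]
    exceeds the mass of the class of [h]; this reserve pays for the lower layers of a chain. *)
Lemma weight_gain k :
    demand B k < demand (fun j => B j + d j) k ->
    level (lv k) (demand (fun j => B j + d j) k).-1 = h ->
  weight B + class_mass p s (h %% s) h < weight (fun j => B j + d j).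
Proof.
move=> lt_dem level_h; set Bd := fun j => _ in lt_dem level_h *.
have dem_size : demand Bd k <= size (lv k) by exact: demand_le_size Bd_box.1.
have hE : h %% s = k by rewrite -level_h level_mod //; lia.
have gain : cost p (lv k) (demand B k) + p ^ h <= cost p (lv k) (demand Bd k).
  apply: leq_trans (_ : cost p (lv k) (demand Bd k).-1.+1 <= _); last first.
    by apply: cost_mono; lia.
  rewrite -addn1 cost_addn ?big_ord1 ?addn0 ?level_h ?leq_add2r; last by lia.
  by apply: cost_mono; lia.
have loss : \sum_(j < s | j != k) cost p (lv j) (demand B j) <=
    \sum_(j < s | j != k) (cost p (lv j) (demand Bd j) + class_mass p s j h).
  apply: leq_sum => j _; have := cost_shift 0 d j (fun=> leq0n _) (fun=> leqnn _).
  by rewrite mul0n subn0 /demand !subn0.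
have weightE W : weight W = cost p (lv k) (demand W k) +
    \sum_(j < s | j != k) cost p (lv j) (demand W j) by exact: bigD1.
have := class_mass_total p s h p_gt0 (s_gt0 k).
rewrite (bigD1 k) //= hE !weightE; move: loss; rewrite big_split /=.
move: gain; clear; move: (p ^ h) (\sum_(j < s | _) class_mass _ _ _ _).
move: (class_mass _ _ _ _).
lia.
Qed.

End Perturbation.

(** Otherwise [p * d k <= d (prv k)] for all [k], and [cyclic_contraction] makes [d] vanish. *)
Lemma demand_increase B d : (exists k, 0 < d k) -> untruncated B ->
  exists k, demand B k < demand (fun j => B j + d j) k.
Proof.
move=> [k0 d_gt0] B_untr; apply: NNPP => no_k.
suff /(_ k0) d0 : forall k, d k = 0 by rewrite d0 in d_gt0.
apply: (cyclic_contraction s p d p_gt1) => k; rewrite leqNgt; apply/negP => lt_d.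
by apply: no_k; exists k; move: (B_untr k) lt_d; rewrite /demand; lia.
Qed.

Lemma weight_perturbation t U B d :
    best t U B -> untruncated B -> box t U (fun k => B k + d k) ->
    (exists k, 0 < d k) ->
  exists h,
    weight B + class_mass p s (h %% s) h < weight (fun k => B k + d k) /\
    forall i eta, (forall k, i <= B k) -> (forall k, eta k <= d k) ->
      weight (fun k => B k - i) <=
      weight (fun k => B k - i + eta k) + (p ^ (h - i * s) - 1).
Proof.
move=> B_best B_untr Bd_box d_pos.
have [k0 lt_k0] := demand_increase B d d_pos B_untr.
set Bd := fun k => B k + d k.
pose top j := level (lv j) (demand Bd j).-1.
case: (@arg_maxnP _ k0 (fun j => demand B j < demand Bd j) top lt_k0) => k lt_k k_max.
exists (top k); split=> [|i eta le_i le_eta].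
  by apply: (weight_gain t U B d (top k) B_best B_untr Bd_box k_max k).
apply: (weight_shift t U B d (top k) B_best B_untr Bd_box k_max) => //.
exact: s_gt0 k.
Qed.

(** * Chains and the exchange of their top vector *)

Lemma eq_weight W Z : W =1 Z -> weight W = weight Z.
Proof. by move=> eqWZ; apply: eq_bigr => k _; rewrite /demand !eqWZ. Qed.

Lemma admissible_meet W Z :
  admissible W -> admissible Z -> admissible (fun k => minn (W k) (Z k)).
Proof. by move=> admW admZ k; have := admW k; have := admZ k; nia. Qed.

Lemma admissible_join W Z :
  admissible W -> admissible Z -> admissible (fun k => maxn (W k) (Z k)).
Proof. by move=> admW admZ k; have := admW k; have := admZ k; nia. Qed.

Lemma admissible_sub i B :
  (forall k, i <= B k) -> admissible B -> admissible (fun k => B k - i).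
Proof. by move=> le_i admB k; have := admB k; have := le_i (prv k); nia. Qed.

(* [W j] is the vector of the (j + 1)-st partial sum. *)
Fixpoint chain (n : nat) U (W : nat -> 'I_s -> nat) : Prop :=
  if n is m.+1 then box n U (W m) /\ chain m (fun k => (W m k).-1) W else True.

Lemma chain_box n U (W : nat -> 'I_s -> nat) j : chain n U W -> j < n ->
  box j.+1 (fun k => U k - (n.-1 - j)) (W j).
Proof.
elim: n U => // n IHn U [[adm_n le_n] chain_n]; rewrite ltnS leq_eqVlt.
case/orP=> [/eqP->|lt_jn]; first by split=> // k; have := le_n k; lia.
have [adm_j le_j] := IHn _ chain_n lt_jn; split=> // k.
by have := le_j k; have := le_n k; lia.
Qed.

Lemma chain_widen n U V (W : nat -> 'I_s -> nat) :
  (forall k, U k <= V k) -> chain n U W -> chain n V W.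
Proof.
case: n => // n le_UV [[adm_n le_n] chain_n]; split=> //; split=> // k.
by have := le_n k; have := le_UV k; lia.
Qed.

(** Both [W j] and the layers [B - (n - j)] grow strictly with [j], hence so do their minima. *)
Lemma chain_meet n m B U (W : nat -> 'I_s -> nat) :
    m <= n -> admissible B -> (forall k, n < B k) -> chain m U W ->
  chain m (fun k => minn (U k) (B k - (n - m).+1))
    (fun j k => minn (W j k) (B k - (n - j))).
Proof.
move=> + admB lt_B; elim: m U => // m IHm U lt_mn [[adm_m le_m] chain_m].
split; last first.
  by apply: chain_widen (IHm _ (ltnW lt_mn) chain_m) => k /=; lia.
split=> [|k]; last by have := le_m k; have := lt_B k; lia.
apply: admissible_meet => //; apply: admissible_sub => // k.
by have := lt_B k; lia.
Qed.

(** The top saves more than the mass of the class of [h] below [h], which by [class_mass_shift]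
    covers the losses of all lower layers. *)
Lemma chain_exchange n U B (W : nat -> 'I_s -> nat) :
    best n.+1 U B -> untruncated B -> chain n.+1 U W ->
    ~ (forall k, W n k <= B k) ->
  \sum_(j < n) weight (fun k => minn (W j k) (B k - (n - j))) + weight B <
  \sum_(j < n.+1) weight (W j).
Proof.
move=> B_best B_untr chainW not_le.
have [[admB B_ge] B_min] := B_best; have [[admWn Wn_ge] _] := chainW.
pose d k := W n k - B k.
have d_pos : exists k, 0 < d k.
  apply: NNPP => d0; apply: not_le => k; rewrite leqNgt; apply/negP => lt_k.
  by apply: d0; exists k; rewrite /d; lia.
have BdE k : maxn (W n k) (B k) = B k + d k by rewrite /d; lia.
have Bd_box : box n.+1 U (fun k => B k + d k).
  split=> k; last by have := B_ge k; have := Wn_ge k; rewrite /d; lia.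
  by have := admissible_join _ _ admWn admB k; rewrite !BdE.
have [h [gain shift]] := weight_perturbation _ _ _ _ B_best B_untr Bd_box d_pos.
(* The meet of [W n] and [B] stays in the box, so it is no lighter than [B]; by submodularity the
   join is no heavier than [W n]. *)
have top_le : weight (fun k => B k + d k) <= weight (W n).
  have := weight_submodular _ _ admWn admB; rewrite (eq_weight _ _ BdE).
  have : weight B <= weight (fun k => minn (W n k) (B k)).
    apply: B_min; split; first exact: admissible_meet.
    by move=> k; have := B_ge k; have := Wn_ge k; lia.
  lia.
have below_le (j : 'I_n) : weight (fun k => minn (W j k) (B k - (n - j))) <=
    weight (W j) + (p ^ (h - (n - j) * s) - 1).
  have [admWj Wj_ge] := chain_box _ _ _ j chainW (ltnW (ltn_ord j)).
  have [_ Wj_le] := chain_box _ _ _ j chainW.2 (ltn_ord j).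
  have le_B k : n - j <= B k by have := B_ge k; lia.
  (* The join of [W j] with its layer is the layer plus [eta]; [eta <= d] because [W j] lies at
     least [n - j] below [W n]. *)
  pose eta k := W j k - (B k - (n - j)).
  have le_eta k : eta k <= d k.
    by have := Wj_le k; have := ltn_ord j; have := Wn_ge k; rewrite /eta /d; lia.
  have := shift _ eta le_B le_eta.
  have := weight_submodular _ _ admWj (admissible_sub _ _ le_B admB).
  rewrite (eq_weight (fun k => maxn _ _) (fun k => B k - (n - j) + eta k)).
    by lia.
  by move=> k; rewrite /eta; lia.
have [k0 _] := d_pos.
have sum_shift : \sum_(j < n) (p ^ (h - (n - j) * s) - 1) <=
    class_mass p s (h %% s) h.
  apply: leq_trans (class_mass_shift p s h n p_gt1 (s_gt0 k0)).
  rewrite big_add1 big_mkord (reindex_inj rev_ord_inj) /=; apply: leq_sum => j _.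
  by rewrite (_ : n - (n - j.+1) = j.+1) //; have := ltn_ord j; lia.
rewrite big_ord_recr /=.
have : \sum_(j < n) weight (fun k => minn (W j k) (B k - (n - j))) <=
    \sum_(j < n) (weight (W j) + (p ^ (h - (n - j) * s) - 1)).
  by apply: leq_sum => j _.
move: gain sum_shift top_le; rewrite big_split /=.
move: (class_mass _ _ _ _) (\sum_(j < n) (_ - 1)) => cm sm; lia.
Qed.

(** * Minimality of greedy chains *)

Fixpoint greedy_chain (n : nat) U (B : nat -> 'I_s -> nat) : Prop :=
  if n is m.+1 then
    [/\ best n U (B m), untruncated (B m) & greedy_chain m (fun k => (B m k).-1) B]
  else True.

(** If the top of [W] lies below [B n], the other vectors compete under the same bound and induction
    applies. Otherwise [chain_exchange] gives a strictly cheaper chain with top [B n]. *)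
Lemma greedy_chain_min n U (B W : nat -> 'I_s -> nat) :
    greedy_chain n U B -> chain n U W ->
  \sum_(j < n) weight (B j) <= \sum_(j < n) weight (W j) /\
  (\sum_(j < n) weight (W j) <= \sum_(j < n) weight (B j) ->
   forall j, j < n -> weight (W j) = weight (B j)).
Proof.
elim: n U W => [|n IHn] U W; first by rewrite !big_ord0.
move=> [B_best B_untr greedyB] chainW.
have [[admB B_ge] B_min] := B_best.
case: (classic (forall k, W n k <= B n k)) => [le_n|nle_n].
  have chainW' : chain n (fun k => (B n k).-1) W.
    by apply: chain_widen chainW.2 => k; have := le_n k; lia.
  have [le_sum eq_sum] := IHn _ W greedyB chainW'.
  have le_top := B_min _ chainW.1.
  rewrite !big_ord_recr /=; split=> [|le_W j]; first by rewrite leq_add.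
  have squeeze a b c e : a + b <= c + e -> c <= a -> e <= b -> a <= c /\ b = e.
    lia.
  have [le_sumW eq_top] := squeeze _ _ _ _ le_W le_sum le_top.
  by rewrite ltnS leq_eqVlt => /orP[/eqP->|]; last exact: eq_sum.
have [|le_sum _] := IHn _ (fun j k => minn (W j k) (B n k - (n - j))) greedyB.
  apply: chain_widen (chain_meet n n (B n) _ W _ admB _ chainW.2) => //.
    by move=> k; have := B_ge k; lia.
  by move=> k; have := B_ge k; lia.
have lt_W := chain_exchange n U (B n) W B_best B_untr chainW nle_n.
have lt_sum : \sum_(j < n.+1) weight (B j) < \sum_(j < n.+1) weight (W j).
  by apply: leq_ltn_trans lt_W; rewrite big_ord_recr leq_add2r.
by split=> [|le_W]; [exact: ltnW | move: lt_sum; rewrite ltnNge le_W].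
Qed.

(** * Existence of nested greedy chains *)

Lemma untruncated_below c t U W : 0 < t ->
    (forall k, t <= W k <= U k) -> (forall k, p * W k <= W (prv k) + c k) ->
  exists Z, [/\ untruncated Z, forall k, t <= Z k <= U k,
    forall k, p * Z k <= Z (prv k) + c k & weight Z <= weight W].
Proof.
move=> t_gt0 W_ge W_c.
pose P Z := [/\ forall k, t <= Z k <= U k,
    forall k, p * Z k <= Z (prv k) + c k & weight Z <= weight W].
have [Z [[Z_ge Z_c Z_le] Z_min]] := ex_minimal P (fun Z => \sum_k Z k)
  (ex_intro _ W (And3 W_ge W_c (leqnn _))).
exists Z; split=> // i; rewrite leqNgt; apply/negP => lt_i.
(* If the demand of class [i] is truncated, lowering [Z (prv i)] by one leaves it at 0 and raises no
   other demand; as [Z (prv i)] exceeds [p * Z i], it stays at least [t]. *)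
pose Y k := if k == prv i then (Z k).-1 else Z k.
have Y_le k : Y k <= Z k by rewrite /Y; case: ifP => _; rewrite ?leq_pred.
have Y_prv k : k != i -> Y (prv k) = Z (prv k).
  by rewrite /Y (inj_eq (@ord_pred_inj s)) => /negbTE->.
have Y_i : Y (prv i) = (Z (prv i)).-1 by rewrite /Y eqxx.
have PY : P Y.
  split=> [k|k|].
  - rewrite /Y; have := Z_ge k; case: eqP => // ->; have := Z_ge i; nia.
  - case: (eqVneq k i) => [->|/Y_prv->]; last by have := Z_c k; have := Y_le k; nia.
    by rewrite Y_i; have := Y_le i; nia.
  - apply: leq_trans Z_le; apply: leq_sum => k _; apply: cost_mono; rewrite /demand.
    case: (eqVneq k i) => [->|/Y_prv->]; last by have := Y_le k; nia.
    by rewrite Y_i; have := Y_le i; nia.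
have := Z_min Y PY; rewrite leqNgt => /negP; apply.
rewrite (bigD1 (prv i)) //= [X in _ < X](bigD1 (prv i)) //= -addSn leq_add //.
  by rewrite Y_i; lia.
by apply: leq_sum => k _.
Qed.

(* [Y] is the least vector above [A] that fits into [B]; it is no dearer than
   [A] because [B - (Y - A)] is no cheaper than [B]. *)
Lemma best_restrict t U B A : best t.+1 U B -> untruncated B ->
    box t (fun k => (B k).-1) A ->
  exists Y, [/\ forall k, t <= Y k <= (B k).-1,
    forall k, p * Y k <= Y (prv k) + demand B k & weight Y <= weight A].
Proof.
move=> [[admB B_ge] B_min] B_untr [admA A_ge].
pose P Y := [/\ forall k, A k <= Y k, forall k, Y k <= (B k).-1 &
  forall k, p * Y k <= Y (prv k) + demand B k].
have PB : P (fun k => (B k).-1).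
  split=> k //; first by have := A_ge k; lia.
  by have := B_untr k; have := B_ge k; have := B_ge (prv k); rewrite /demand; nia.
have [Y [[Y_geA Y_leB Y_dem] Y_min]] :=
  ex_minimal P (fun Z => \sum_k Z k) (ex_intro _ _ PB).
(* As [Y] is least, lowering it at [prv k] must break the bound of class [k], which is therefore an
   equality. *)
have Y_tight k : A (prv k) < Y (prv k) -> p * Y k = Y (prv k) + demand B k.
  move=> lt_k; apply/eqP; rewrite eqn_leq Y_dem leqNgt; apply/negP => lt_dem.
  pose Z j := if j == prv k then (Y j).-1 else Y j.
  have Z_le j : Z j <= Y j by rewrite /Z; case: ifP => _; rewrite ?leq_pred.
  have Z_k : Z (prv k) = (Y (prv k)).-1 by rewrite /Z eqxx.
  have PZ : P Z.
    split=> j; last 1 first.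
    - case: (eqVneq j k) => [->|jk]; first by rewrite Z_k; have := Z_le k; nia.
      rewrite {2}/Z (inj_eq (@ord_pred_inj s)) (negbTE jk).
      by have := Y_dem j; have := Z_le j; nia.
    - by rewrite /Z; have := Y_geA j; case: eqP => // ->; lia.
    - exact: leq_trans (Z_le j) (Y_leB j).
  have := Y_min Z PZ; rewrite leqNgt => /negP; apply.
  rewrite (bigD1 (prv k)) //= [X in _ < X](bigD1 (prv k)) //= -addSn leq_add //.
    by rewrite Z_k; lia.
  by apply: leq_sum => j _.
exists Y; split=> // [k|].
  by have := A_ge k; have := Y_geA k; have := Y_leB k; lia.
pose C k := B k - (Y k - A k).
have CE k : C k + Y k = B k + A k.
  by have := Y_geA k; have := Y_leB k; rewrite /C; lia.
have C_box : box t.+1 U C.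
  split=> k; last first.
    by have := A_ge k; have := B_ge k; have := Y_leB k; rewrite /C; lia.
  have := CE k; have := CE (prv k); have := B_untr k; have := admB k.
  have := admA k; have := Y_geA k; have := Y_geA (prv k); have := Y_tight k.
  by rewrite /demand; nia.
rewrite -(leq_add2r (weight C)).
apply: leq_trans (_ : weight A + weight B <= _); last by rewrite leq_add2l B_min.
rewrite /weight -!big_split; apply: leq_sum => k _ /=.
have dem_le := demand_le_size B k admB.
have := CE k; have := CE (prv k); have := B_untr k.
have := Y_geA k; have := Y_geA (prv k).
(* Either class [k] is tight, and [Y] and [C] have the demands of [B] and [A]; or [Y] agrees with
   [A] at [prv k], and their demands lie between those of [A] and [B]. *)
case: (ltnP (A (prv k)) (Y (prv k))) => [/Y_tight tight|le_prv] *.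
  have -> : demand Y k = demand B k by rewrite /demand in tight *; lia.
  have -> : demand C k = demand A k by rewrite /demand in tight *; nia.
  by rewrite addnC.
have pCE : p * C k + p * Y k = p * B k + p * A k by rewrite -!mulnDr CE.
have le_pA : p * A k <= p * Y k by rewrite leq_mul2l Y_geA orbT.
have le_pC : p * C k <= p * B k by rewrite leq_mul2l leq_subr orbT.
have Y_demk := Y_dem k.
by apply: cost_exchange => //; rewrite /demand in dem_le Y_demk *; lia.
Qed.

Lemma best_exists t U : 0 < t -> (exists W, box t U W) ->
  exists B, best t U B /\ untruncated B.
Proof.
move=> t_gt0 /(ex_minimal _ weight)[W [[admW W_ge] W_min]].
have [Z [Z_untr Z_ge admZ le_Z]] := untruncated_below _ _ _ _ t_gt0 W_ge admW.
exists Z; split=> //; split=> // Y boxY.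
exact: leq_trans le_Z (W_min Y boxY).
Qed.

(** A lightest vector under [B] is moved by [best_restrict] to one whose demands fit into those of
    [B], then freed of truncation by [untruncated_below] with these demands as bound. Neither move
    raises the weight. *)
Lemma best_next t U B : 0 < t -> best t.+1 U B -> untruncated B ->
  exists A, [/\ best t (fun k => (B k).-1) A, untruncated A &
    forall k, demand A k <= demand B k].
Proof.
move=> t_gt0 B_best B_untr; have [[admB B_ge] _] := B_best.
have [|A [A_best _]] := best_exists t (fun k => (B k).-1) t_gt0.
  exists (fun k => (B k).-1); split=> k; last by have := B_ge k; lia.
  by have := admB k; have := B_ge (prv k); have := B_ge k; nia.
have [Y [Y_ge Y_dem le_Y]] := best_restrict _ _ _ _ B_best B_untr A_best.1.
have [Z [Z_untr Z_ge Z_dem le_Z]] := untruncated_below _ _ _ _ t_gt0 Y_ge Y_dem.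
exists Z; split=> // [|k]; last first.
  by have := Z_dem k; rewrite {2}/demand; lia.
split=> [|W boxW].
  split=> // k; have := Z_dem k; have := demand_le_size B k admB; lia.
exact: leq_trans le_Z (leq_trans le_Y (A_best.2 W boxW)).
Qed.

Lemma eq_greedy_chain n U (B C : nat -> 'I_s -> nat) :
  (forall j, j < n -> B j = C j) -> greedy_chain n U B -> greedy_chain n U C.
Proof.
elim: n U => // n IHn U eqBC [B_best B_untr greedyB].
rewrite /= -eqBC //; split=> //; apply: IHn => // j lt_jn.
exact: eqBC (ltnW lt_jn).
Qed.

Lemma greedy_chain_exists n U : 0 < n -> (exists W, box n U W) ->
  exists B : nat -> 'I_s -> nat, greedy_chain n U B /\
    forall j, j.+1 < n -> forall k, demand (B j) k <= demand (B j.+1) k.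
Proof.
case: n => // n _ /(best_exists _ _ (ltn0Sn n))[B0 [B0_best B0_proper]].
suff [B [_ greedyB nested]] : exists B : nat -> 'I_s -> nat, [/\ B n = B0,
    greedy_chain n.+1 U B & forall j, j.+1 < n.+1 -> forall k,
    demand (B j) k <= demand (B j.+1) k] by exists B.
elim: n U B0 B0_best B0_proper => [|n IHn] U B0 B0_best B0_proper.
  by exists (fun=> B0).
have [A [A_best A_untr le_dem]] := best_next _ _ _ (ltn0Sn n) B0_best B0_proper.
have [B [BE greedyB nested]] := IHn _ _ A_best A_untr.
exists (fun j => if j == n.+1 then B0 else B j); rewrite eqxx; split=> //.
  rewrite /= eqxx; split=> //.
  apply: (eq_greedy_chain n.+1 _ B) greedyB => j lt_jn.
  by rewrite (ltn_eqF lt_jn).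
move=> j; rewrite !ltnS => le_jn k; rewrite (ltn_eqF (_ : j < n.+1)) //.
case: eqP => [[eq_j]|neq]; first by rewrite eq_j BE.
by apply: nested; lia.
Qed.

Lemma greedy_chain_chain n U
    (B : nat -> 'I_s -> nat) :
  greedy_chain n U B -> chain n U B.
Proof. by elim: n U => // n IHn U [[boxB _] _ /IHn]. Qed.

(** Serves the lexicographic comparison: [B j.+1] already obeys the upper bounds set by the later
    vectors. *)
Lemma greedy_chain_best n U
    (B : nat -> 'I_s -> nat) j W :
    greedy_chain n U B -> j < n -> box j.+1 U W ->
    (j.+1 < n -> forall k, W k < B j.+1 k) ->
  weight (B j) <= weight W.
Proof.
elim: n U => // n IHn U [B_best _ greedyB]; rewrite ltnS leq_eqVlt.
case/orP=> [/eqP->|lt_jn] boxW W_lt; first exact: B_best.2.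
apply: (IHn _ greedyB) => // [|lt_j]; last by apply: W_lt; lia.
split=> [|k]; first exact: boxW.1.
have := W_lt lt_jn k; have := boxW.2 k.
move: lt_jn; rewrite leq_eqVlt => /orP[/eqP<-|lt_j]; first by lia.
have [_ /(_ k)] := chain_box _ _ _ _ (greedy_chain_chain _ _ _ greedyB) lt_j.
lia.
Qed.

Lemma chain_intro n U
    (W : nat -> 'I_s -> nat) :
    (forall j, j < n -> admissible (W j)) ->
    (forall j k, j < n -> j < W j k) ->
    (forall j k, j.+1 < n -> W j k < W j.+1 k) ->
    (forall k, 0 < n -> W n.-1 k <= U k) ->
  chain n U W.
Proof.
elim: n U => // n IHn U admW W_ge W_lt W_le; split.
  by split=> [|k]; [exact: admW | rewrite W_ge // W_le].
apply: IHn => [j|j k|j k|k n_gt0]; [by move/ltnW/admW | | |].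
- by move/ltnW/W_ge.
- by move/ltnW/W_lt.
- by have := W_lt n.-1 k; rewrite prednK //; lia.
Qed.

(** At a largest coordinate, [(p - 1) * W k <= size (lv k)]. This supplies the bound [U] used for
    compositions. *)
Lemma admissible_bound W k :
  admissible W -> W k <= \sum_j size (lv j).
Proof.
move=> admW; case: (@arg_maxnP _ k predT W isT) => i _ i_max.
apply: leq_trans (i_max k isT) _; rewrite (bigD1 i) //=.
apply: leq_trans (leq_addr _ _).
by have := admW i; have := i_max (ord_pred i) isT; nia.
Qed.

Lemma chain_lt n U (W : nat -> 'I_s -> nat) j k :
  chain n U W -> j.+1 < n -> W j k < W j.+1 k.
Proof.
elim: n U => // n IHn U [_ chain_n]; rewrite ltnS leq_eqVlt.
case/orP=> [/eqP eq_n|]; last exact: IHn chain_n.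
have [_ /(_ k)] := chain_box n _ W j chain_n ltac:(by rewrite -eq_n).
by rewrite -eq_n; lia.
Qed.

Lemma greedy_chain_untruncated n U (B : nat -> 'I_s -> nat) j :
  greedy_chain n U B -> j < n -> untruncated (B j).
Proof.
elim: n U => // n IHn U [_ B_untr greedyB]; rewrite ltnS leq_eqVlt.
by case/orP=> [/eqP->|] //; exact: IHn greedyB.
Qed.

End Optimization.

(** * Digit multisets and their vectors *)

Definition value (p M : nat) (D : nat -> nat) : nat := \sum_(h < M) D h * p ^ h.

Lemma value_lt (p M : nat) (D : nat -> nat) :
  (forall h, D h < p) -> value p M D < p ^ M.
Proof.
move=> D_lt; rewrite /value; elim: M => [|n IHn]; first by rewrite big_ord0.
rewrite big_ord_recr /= expnS; apply: (@leq_trans ((D n).+1 * p ^ n)).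
  by rewrite mulSn -addSn leq_add2r.
by rewrite leq_mul2r D_lt orbT.
Qed.

Lemma digit0 (p x : nat) : digit p 0 x = x %% p.
Proof. by rewrite /digit expn0 divn1. Qed.

Lemma digitS (p h x : nat) : digit p h.+1 x = digit p h (x %/ p).
Proof. by rewrite /digit expnS divnMA. Qed.

Lemma digit_small (p h x : nat) : x < p ^ h -> digit p h x = 0.
Proof. by move=> x_lt; rewrite /digit divn_small // mod0n. Qed.

Lemma valueS (p M : nat) (D : nat -> nat) :
  value p M.+1 D = value p M (fun h => D h.+1) * p + D 0.
Proof.
rewrite /value big_ord_recl expn0 muln1 addnC big_distrl; congr (_ + _).
by apply: eq_bigr => h _; rewrite /= /bump expnSr mulnA.
Qed.

Lemma digit_value (p M : nat) (D : nat -> nat) h : 1 < p ->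
  (forall h, D h < p) -> h < M -> digit p h (value p M D) = D h.
Proof.
move=> p_gt1; elim: M D h => // M IHM D h D_lt; rewrite valueS.
case: h => [|h] lt_h; first by rewrite digit0 modnMDl modn_small.
by rewrite digitS divnMDl ?divn_small ?addn0 ?IHM //; lia.
Qed.

Lemma value_digit (p M x : nat) : 1 < p -> x < p ^ M ->
  value p M (fun h => digit p h x) = x.
Proof.
move=> p_gt1; elim: M x => [|M IHM] x x_lt.
  by rewrite /value big_ord0; move: x_lt; rewrite expn0; lia.
rewrite valueS digit0 [RHS](divn_eq x p); congr (_ * _ + _).
rewrite -[RHS]IHM; last by rewrite ltn_divLR -?expnSr //; lia.
by apply: eq_bigr => h _; rewrite digitS.
Qed.

Section Digits.

Variables (p s M : nat).
Hypotheses (p_gt1 : 1 < p) (s_gt0 : 0 < s).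

Implicit Types (D E : nat -> nat) (k : 'I_s).

Definition class_count D k : nat := \sum_(h < M | h %% s == k) D h.

Definition units D k : seq nat :=
  flatten [seq nseq (D h) h | h <- iota 0 M & h %% s == k].

Lemma big_units D k (F : nat -> nat) :
  \sum_(x <- units D k) F x = \sum_(h < M | h %% s == k) D h * F h.
Proof.
rewrite /units big_flatten big_map big_filter -[M in iota 0 M]subn0.
rewrite -(big_mkord (fun h => h %% s == k) (fun h => D h * F h)).
by apply: eq_bigr => h _; rewrite big_nseq iter_addn_0 mulnC.
Qed.

Lemma size_units D k : size (units D k) = class_count D k.
Proof.
rewrite -sum1_size big_units; apply: eq_bigr => h _; exact: muln1.
Qed.

Lemma count_units D k x :
  count_mem x (units D k) = (x < M) * (x %% s == k) * D x.
Proof.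
rewrite -sum1_count big_mkcond big_units /=.
case: (ltnP x M) => [lt_xM|le_Mx]; last first.
  rewrite big1 // => h _; case: eqP => [eq_h|]; last by rewrite muln0.
  by move: (ltn_ord h); rewrite eq_h ltnNge le_Mx.
rewrite big_mkcond (bigD1 (Ordinal lt_xM)) //= eqxx big1 => [|h].
  by case: eqP; rewrite ?muln1 ?mul1n ?mul0n addn0.
rewrite -val_eqE /= => /negbTE->; rewrite muln0; exact: if_same.
Qed.

Lemma sorted_units D k : sorted leq (units D k).
Proof.
rewrite sorted_pairwise; last exact: leq_trans.
rewrite /units; have : pairwise leq [seq h <- iota 0 M | h %% s == k].
  rewrite -sorted_pairwise; last exact: leq_trans.
  by apply: sorted_filter; [exact: leq_trans | exact: iota_sorted].
elim: [seq _ <- _ | _] => //= h r IHr /andP[h_le /IHr pair_r].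
rewrite pairwise_cat pair_r andbT; apply/andP; split.
  apply/allrelP => a b; rewrite mem_nseq => /andP[_ /eqP->] /flatten_mapP[c].
  by move=> /(allP h_le) le_hc; rewrite mem_nseq => /andP[_ /eqP->].
apply/(pairwiseP 0) => a b; rewrite !inE size_nseq => la lb _.
by rewrite !nth_nseq la lb.
Qed.

Lemma subseq_units D E k : (forall h, D h <= E h) -> subseq (units D k) (units E k).
Proof.
move=> le_DE; rewrite /units; elim: [seq _ <- _ | _] => //= h r IHr.
apply: cat_subseq => //; rewrite -(subnKC (le_DE h)) nseqD.
exact: prefix_subseq.
Qed.

Lemma sum_by_class (F : nat -> nat) :
  \sum_(k < s) \sum_(h < M | h %% s == k) F h = \sum_(h < M) F h.
Proof.
rewrite (eq_bigr _ (fun k _ => big_mkcond _ _)) exchange_big /=.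
apply: eq_bigr => h _; rewrite -big_mkcond /=.
by rewrite (big_pred1 (Ordinal (ltn_pmod h s_gt0))).
Qed.

(** The [i]-th entry of a subsequence of a sorted list is at least the [i]-th entry of the list. *)
Lemma cost_take_le (l r : seq nat) : sorted leq l -> subseq r l ->
  cost p l (size r) <= \sum_(x <- r) p ^ x.
Proof.
rewrite /cost; elim: l r => [|x l IHl] [|y r] //=; rewrite ?take0 ?big_nil //.
move=> l_sorted sub_r; have l_sorted' := path_sorted l_sorted.
have sub_tail : subseq r l.
  case: eqP sub_r => // _; apply: subseq_trans; exact: subseq_cons.
have le_xy : x <= y.
  have : y \in x :: l.
    by apply: (mem_subseq (s1 := y :: r)); rewrite ?mem_head //=.
  rewrite inE => /orP[/eqP-> //|]; apply/allP.
  exact: order_path_min leq_trans l_sorted.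
by rewrite !big_cons leq_add ?leq_pexp2l ?IHl // ltnW.
Qed.

Lemma cost_units_le D E k : (forall h, D h <= E h) ->
  cost p (units E k) (class_count D k) <= \sum_(h < M | h %% s == k) D h * p ^ h.
Proof.
move=> le_DE; rewrite -size_units -big_units.
by apply: cost_take_le; [exact: sorted_units | exact: subseq_units].
Qed.

(** * Divisibility by [p ^ s - 1] and integral vectors *)

Notation prv := (@ord_pred s).
Notation Q := (p ^ s - 1).

Let Q_gt0 : 0 < Q.
Proof. by rewrite subn_gt0 -(exp1n s) ltn_exp2r. Qed.

Lemma val_prv k : prv k = (if k == 0 :> nat then s.-1 else k.-1) :> nat.
Proof.
rewrite /=; have := ltn_ord k; case: eqP => [->|k_neq0] k_lt.
  by rewrite add0n modn_small; lia.
by rewrite (_ : (k + s).-1 = k.-1 + s) ?modnDr ?modn_small; lia.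
Qed.

(* The exponent is [(i - k - 1) mod s]. *)
Definition rotation D k : nat :=
  \sum_(i < s) class_count D i * p ^ (if i <= k then s.-1 - (k - i) else i - k.+1).

(** Multiplication by [p] turns the exponents into those for [prv k], except that class [k] gets
    exponent [s] instead of 0, a surplus of [p ^ s - 1] per unit. *)
Lemma rotation_step D k :
  p * rotation D k = rotation D (prv k) + Q * class_count D k.
Proof.
have := ltn_ord k; rewrite /rotation; move: (prv k) (val_prv k) => j jE k_lt.
rewrite big_distrr (bigD1 k) // [in RHS](bigD1 k) //= leqnn addnAC.
congr (_ + _).
  rewrite mulnCA -expnS subnn subn0 prednK // [Q * _]mulnC -mulnDr.
  congr (_ * _); have Q_pos := Q_gt0.
  rewrite (_ : (if _ then _ else _) = 0) ?expn0; first by lia.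
  by rewrite jE; case: eqP => ?; case: ifP; lia.
apply: eq_bigr => i; rewrite -val_eqE /= => ik; have := ltn_ord i => i_lt.
rewrite mulnCA -expnS; congr (_ * p ^ _); rewrite jE.
by case: (eqVneq (k : nat) 0) => k0; case: (leqP i k) => ?; case: ifP => ?; lia.
Qed.

Lemma class_sum_mod D :
  value p M D = \sum_(i < s) class_count D i * p ^ i %[mod Q].
Proof.
have QE : p ^ s = 1 + Q by have := Q_gt0; lia.
have pow_mod h : p ^ h = p ^ (h %% s) %[mod Q].
  rewrite {1}(divn_eq h s) expnD [_ * s]mulnC expnM -modnMml -modnXm {1}QE modnDr.
  by rewrite modnXm exp1n modnMml mul1n.
rewrite /value -modn_summ; under eq_bigr => h _ do rewrite -modnMmr pow_mod modnMmr.
rewrite modn_summ -(sum_by_class (fun h => D h * p ^ (h %% s))).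
congr (_ %% _); apply: eq_bigr => i _.
by rewrite /class_count big_distrl; apply: eq_bigr => h /eqP->.
Qed.

(** The rotation at [s - 1] is the sum in [class_sum_mod]; [rotation_step] carries divisibility from
    [k + 1] down to [k]. *)
Lemma rotation_div D k : Q %| value p M D -> Q %| rotation D k.
Proof.
move=> Q_dvd; have [n] := ubnP (s - k); elim: n k => // n IHn k lt_n.
have [lt_k|ge_k] := ltnP k.+1 s.
  have := IHn (Ordinal lt_k); rewrite /= => /(_ ltac:(lia)) Q_rot.
  have prvE : prv (Ordinal lt_k) = k by apply: val_inj; exact: etrans (val_prv _) _.
  have := rotation_step D (Ordinal lt_k); rewrite prvE => rotE.
  have Q_count := dvdn_mulr (class_count D (Ordinal lt_k)) (dvdnn Q).
  by rewrite -(dvdn_addl _ Q_count) -rotE dvdn_mull.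
move: Q_dvd; rewrite /dvdn class_sum_mod -/(dvdn _ _).
congr (_ %| _); apply: eq_bigr => i _; congr (_ * p ^ _).
by have := ltn_ord i; case: ifP; have := ltn_ord k; lia.
Qed.

(* The vector W of the header: p W_k - W_(k-1) is the number of units of class
   [k], see [coord_step]. *)
Definition coord D k : nat := rotation D k %/ Q.

Lemma coord_step D k : Q %| value p M D ->
  p * coord D k = coord D (prv k) + class_count D k.
Proof.
move=> Q_dvd; rewrite /coord muln_divA ?rotation_div // rotation_step.
by rewrite divnDr ?mulKn // dvdn_mulr.
Qed.

(** Both truncated differences of two solutions satisfy the hypothesis of [cyclic_contraction]. *)
Lemma coord_unique D W : Q %| value p M D ->
  (forall k, p * W k = W (prv k) + class_count D k) -> W =1 coord D.
Proof.
move=> Q_dvd W_step k.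
have W_le k0 : W k0 - coord D k0 = 0.
  apply: (cyclic_contraction s p (fun k => W k - coord D k) p_gt1) => j.
  by rewrite mulnBr W_step coord_step //; lia.
have W_ge k0 : coord D k0 - W k0 = 0.
  apply: (cyclic_contraction s p (fun k => coord D k - W k) p_gt1) => j.
  by rewrite mulnBr W_step coord_step //; lia.
by have := W_le k; have := W_ge k; lia.
Qed.

(** Weighting the equations by [p ^ k] and adding, the terms in [W] cancel around the cycle up to a
    multiple of [p ^ s - 1]. *)
Lemma coord_div D W :
  (forall k, p * W k = W (prv k) + class_count D k) -> Q %| value p M D.
Proof.
move=> W_step; rewrite /dvdn class_sum_mod -/(dvdn _ _).
have pow_next (j : 'I_s) :
    W j * p ^ j.+1 = W j * p ^ ordS j + Q * (if j.+1 == s then W j else 0).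
  have := ltn_ord j; rewrite /=; case: eqP => [->|neq] lt_j.
    have pE : p ^ s = 1 + Q by have := Q_gt0; lia.
    by rewrite modnn expn0 {1}pE mulnDr [_ * Q]mulnC.
  by rewrite muln0 addn0 modn_small //; lia.
have sumE : \sum_(i < s) class_count D i * p ^ i + \sum_(j < s) W j * p ^ ordS j =
    \sum_(j < s) W j * p ^ j.+1.
  rewrite [X in _ + X](reindex_inj (@ord_pred_inj s)).
  rewrite [X in _ + X](eq_bigr (fun i : 'I_s => W (prv i) * p ^ i)); last first.
    by move=> i _; rewrite ord_predK.
  rewrite -big_split; apply: eq_bigr => i _ /=.
  by rewrite -mulnDl addnC -W_step expnS mulnCA mulnA.
move: sumE; rewrite (eq_bigr _ (fun j _ => pow_next j)) big_split addnC.
by move=> /addnI ->; apply: dvdn_sum => j _; exact: dvdn_mulr.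
Qed.

Lemma coord_add D E k : Q %| value p M D -> Q %| value p M E ->
  coord (fun h => D h + E h) k = coord D k + coord E k.
Proof.
move=> Q_D Q_E; rewrite /coord -divnDl ?rotation_div //; congr (_ %/ _).
rewrite /rotation -big_split; apply: eq_bigr => i _ /=.
by rewrite -mulnDl; congr (_ * _); rewrite /class_count -big_split.
Qed.

Lemma coord_gt0 D k : Q %| value p M D -> 0 < value p M D -> 0 < coord D k.
Proof.
move=> Q_dvd val_gt0; rewrite divn_gt0 //; apply: dvdn_leq; last exact: rotation_div.
rewrite lt0n; apply: contraTneq val_gt0 => rot0; rewrite -leqNgt leqn0.
have D0 (h : 'I_M) : D h = 0.
  move: rot0; rewrite /rotation => /eqP; rewrite sum_nat_eq0 => /forallP.
  move=> /(_ (Ordinal (ltn_pmod h s_gt0))); rewrite implyTb muln_eq0 expn_eq0.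
  have -> : (p == 0) = false by lia.
  rewrite andFb orbF.
  rewrite /class_count sum_nat_eq0 => /forallP /(_ h) /implyP /(_ (eqxx _)).
  by move/eqP.
by rewrite /value big1 // => h _; rewrite D0.
Qed.

Lemma eq_coord D E : (forall h, h < M -> D h = E h) -> coord D =1 coord E.
Proof.
move=> eqDE k; congr (_ %/ _); apply: eq_bigr => i _; congr (_ * _).
by apply: eq_bigr => h _; exact: eqDE.
Qed.

Lemma coord_gt0_value D k : 0 < coord D k -> 0 < value p M D.
Proof.
apply: contraTltn; rewrite leqn0 /value sum_nat_eq0 => /forallP D0.
rewrite /coord /rotation big1 ?div0n // => i _.
rewrite /class_count big1 // => h _; have := D0 h; rewrite implyTb muln_eq0 expn_eq0.
have -> : (p == 0) = false by lia.
by rewrite andFb orbF => /eqP.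
Qed.

Lemma perm_units_count (r : seq nat) k :
    {in r, forall x, x < M /\ x %% s = k} ->
  perm_eq (units (fun h => count_mem h r) k) r.
Proof.
move=> r_class; apply/allP => x _; rewrite /= count_units.
have [/r_class[-> ->]|x_notin] := boolP (x \in r); first by rewrite eqxx !mul1n.
by rewrite (count_memPn x_notin) muln0.
Qed.

Lemma value_add D E : value p M (fun h => D h + E h) = value p M D + value p M E.
Proof. by rewrite /value -big_split; apply: eq_bigr => h _; rewrite /= mulnDl. Qed.

Lemma eq_value D E : D =1 E -> value p M D = value p M E.
Proof. by move=> eqDE; apply: eq_bigr => h _; rewrite eqDE. Qed.

(** * Compositions as chains *)

Section Compositions.

Variables (n N : nat).
Hypothesis N_lt : N < p ^ M.

Notation m := n.+1.

Implicit Types (X : m.-tuple nat) (B : nat -> 'I_s -> nat).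

Let lv k := units (fun h => digit p h N) k.

Let U : 'I_s -> nat := fun=> \sum_k size (lv k).

Let lv_sorted k : sorted leq (lv k). Proof. exact: sorted_units. Qed.

Let lv_count k x : count_mem x (lv k) <= (x %% s == k) * p.-1.
Proof.
rewrite count_units; case: (x < M); rewrite ?mul1n ?mul0n // leq_mul2l.
by have := ltn_pmod (N %/ p ^ x) (ltnW p_gt1); rewrite /digit; lia.
Qed.

Definition psum X j : nat := \sum_(i < j.+1) nth 0 X i.

(** For a valid [X] these are the digits of [psum X j], as no carries occur. *)
Definition dsum X j h : nat := \sum_(i < j.+1) digit p h (nth 0 X i).

Lemma partial_sum_le (F : nat -> nat) j : j < m ->
  \sum_(i < j.+1) F i <= \sum_(i < m) F i.
Proof.
move=> lt_jm; rewrite -!(big_mkord xpredT F).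
by rewrite [X in _ <= X](@big_cat_nat _ _ _ j.+1) //= leq_addr.
Qed.

Lemma sum_tnth X (F : nat -> nat) :
  \sum_(i < m) F (tnth X i) = \sum_(i < m) F (nth 0 X i).
Proof. by apply: eq_bigr => i _; rewrite (tnth_nth 0). Qed.

(** * From valid compositions to chains *)

Section Valid.

Variable X : m.-tuple nat.
Hypothesis X_valid : valid p s N X.

Lemma valid_psum_last : psum X n = N.
Proof. by have [[_ <-] _ _] := X_valid; rewrite (sum_tnth X id). Qed.

Lemma valid_gt0 i : i < m -> 0 < nth 0 X i.
Proof.
move=> lt_im; have [[+ _] _ _] := X_valid.
by move=> /(_ (Ordinal lt_im)); rewrite (tnth_nth 0).
Qed.

Lemma valid_dvd i : i < n -> Q %| nth 0 X i.
Proof.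
move=> lt_in; have [_ _ /(_ (Ordinal (ltnW lt_in : i < m)))] := X_valid.
by rewrite (tnth_nth 0); apply.
Qed.

Lemma valid_dsum_le j h : j < m -> dsum X j h <= digit p h N.
Proof.
move=> lt_jm; have [_ <- _] := X_valid; rewrite sum_tnth.
exact: partial_sum_le (fun i => digit p h (nth 0 X i)) _ lt_jm.
Qed.

Lemma valid_value_digit i : i < m ->
  value p M (fun h => digit p h (nth 0 X i)) = nth 0 X i.
Proof.
move=> lt_im; apply: value_digit => //; apply: leq_ltn_trans N_lt.
rewrite -valid_psum_last /psum (bigD1 (Ordinal lt_im)) //=; exact: leq_addr.
Qed.

Lemma valid_value_dsum j : j < m -> value p M (dsum X j) = psum X j.
Proof.
elim: j => [|j IHj] lt_jm.
  rewrite /psum big_ord1 -(valid_value_digit 0) //; apply: eq_value => h.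
  by rewrite /dsum big_ord1.
rewrite /psum big_ord_recr /= -/(psum X j) -IHj ?(ltnW lt_jm) //.
rewrite -(valid_value_digit j.+1) // -value_add; apply: eq_value => h.
by rewrite /dsum big_ord_recr.
Qed.

Lemma valid_psum_dvd j : j < n -> Q %| psum X j.
Proof.
move=> lt_jn; apply: dvdn_sum => i _; apply: valid_dvd.
exact: leq_ltn_trans (leq_ord i) lt_jn.
Qed.

Lemma valid_coord_step j k : j < n ->
  p * coord (dsum X j) k = coord (dsum X j) (prv k) + class_count (dsum X j) k.
Proof.
by move=> lt_jn; rewrite coord_step // valid_value_dsum ?valid_psum_dvd // ltnW.
Qed.

Lemma valid_coord_admissible j : j < n -> admissible p s lv (coord (dsum X j)).
Proof.
move=> lt_jn k; rewrite valid_coord_step // leq_add2l size_units.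
by apply: leq_sum => h _; apply: valid_dsum_le; exact: ltnW.
Qed.

Lemma valid_coord_lt j k : j.+1 < n -> coord (dsum X j) k < coord (dsum X j.+1) k.
Proof.
move=> lt_jn; have lt_jm := ltnW (ltnW lt_jn : j.+1 < m).
rewrite (eq_coord (dsum X j.+1) (fun h => dsum X j h + digit p h (nth 0 X j.+1))).
  have Q_X : Q %| value p M (fun h => digit p h (nth 0 X j.+1)).
    by rewrite valid_value_digit ?valid_dvd // ltnW.
  rewrite coord_add //; last by rewrite valid_value_dsum ?valid_psum_dvd // ltnW.
  rewrite -[X in X < _]addn0 ltn_add2l coord_gt0 //.
  by rewrite valid_value_digit ?valid_gt0 // ltnW.
by move=> h _; rewrite /dsum big_ord_recr.
Qed.

Lemma valid_coord_ge j k : j < n -> j < coord (dsum X j) k.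
Proof.
elim: j => [|j IHj] lt_jn; last first.
  exact: leq_ltn_trans (IHj (ltnW lt_jn)) (valid_coord_lt j k lt_jn).
rewrite coord_gt0 ?valid_value_dsum ?valid_psum_dvd //.
by rewrite /psum big_ord1 valid_gt0.
Qed.

Lemma valid_coord_box j : j < n -> box p s lv j.+1 U (coord (dsum X j)).
Proof.
move=> lt_jn; split=> [|k]; first exact: valid_coord_admissible.
rewrite valid_coord_ge //=; apply: (admissible_bound p s lv) => //.
exact: valid_coord_admissible.
Qed.

Lemma valid_chain : chain p s lv n U (fun j => coord (dsum X j)).
Proof.
apply: (chain_intro p s lv p_gt1) => [j|j k|j k|k n_gt0].
- exact: valid_coord_admissible.
- exact: valid_coord_ge.
- exact: valid_coord_lt.
- by have [_ /(_ k) /andP[]] := valid_coord_box n.-1 ltac:(by rewrite ltn_predL).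
Qed.

Lemma valid_weight_le j : j < n -> weight p s lv (coord (dsum X j)) <= psum X j.
Proof.
move=> lt_jn; rewrite -valid_value_dsum; last exact: ltnW.
rewrite /value.
rewrite -(sum_by_class (fun h => dsum X j h * p ^ h)); apply: leq_sum => k _.
rewrite /demand valid_coord_step // addKn; apply: cost_units_le => h.
by apply: valid_dsum_le; exact: ltnW.
Qed.

End Valid.

(** * From nested chains to compositions *)

Section Realization.

Variable B : nat -> 'I_s -> nat.
Hypothesis B_adm : forall j, j < n -> admissible p s lv (B j).
Hypothesis B_untr : forall j, j < n -> untruncated p s (B j).
Hypothesis B_gt0 : forall j k, j < n -> 0 < B j k.
Hypothesis B_lt : forall j k, j.+1 < n -> B j k < B j.+1 k.
Hypothesis B_nested : forall j k, j.+1 < n ->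
  demand p s (B j) k <= demand p s (B j.+1) k.
Hypothesis B_weight : forall j, j.+1 = n -> weight p s lv (B j) < N.
Hypothesis N_gt0 : 0 < N.

Let cls h : 'I_s := Ordinal (ltn_pmod h s_gt0).

(** The multiset of the smallest units meeting the demands of [B j]; at [j = n] it is all of [N], so
    the last part receives the remaining units. *)
Definition realized_digit j h : nat :=
  if j < n then count_mem h (take (demand p s (B j) (cls h)) (lv (cls h)))
  else digit p h N.

Lemma realized_digit_le j h : realized_digit j h <= digit p h N.
Proof.
rewrite /realized_digit; case: ifP => // _.
rewrite (leq_trans (leq_count_subseq _ (take_subseq _ _))) // count_units.
by case: (h < M); case: (_ == _); rewrite ?mul1n ?mul0n.
Qed.

Lemma realized_digit_mono j h : realized_digit j h <= realized_digit j.+1 h.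
Proof.
rewrite {2}/realized_digit; case: ifP => [lt_j|_]; last exact: realized_digit_le.
rewrite /realized_digit (ltnW lt_j); set l := lv _.
rewrite -(take_takel l (B_nested j (cls h) lt_j)).
exact: leq_count_subseq _ (take_subseq _ _).
Qed.

Lemma realized_perm j k : j < n ->
  perm_eq (units (realized_digit j) k) (take (demand p s (B j) k) (lv k)).
Proof.
move=> lt_jn; set r := take _ _.
have -> : units (realized_digit j) k = units (fun h => count_mem h r) k.
  rewrite /units; congr flatten; apply/eq_in_map => h.
  rewrite mem_filter => /andP[/eqP hk _]; rewrite /realized_digit lt_jn.
  by rewrite (_ : cls h = k) //; apply: val_inj.
apply: perm_units_count => x /mem_take; rewrite -has_pred1 has_count count_units.
by case: (x < M); case: eqP.
Qed.

Lemma realized_class_count j k : j < n ->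
  class_count (realized_digit j) k = demand p s (B j) k.
Proof.
move=> lt_jn; rewrite -size_units (perm_size (realized_perm j k lt_jn)) size_takel //.
exact: demand_le_size (B_adm j lt_jn).
Qed.

Lemma realized_value j : j < n ->
  value p M (realized_digit j) = weight p s lv (B j).
Proof.
move=> lt_jn; rewrite /value -(sum_by_class (fun h => _ h * p ^ h)).
apply: eq_bigr => k _.
by rewrite -(big_units _ _ (fun h => p ^ h)) (perm_big _ (realized_perm j k lt_jn)).
Qed.

Lemma realized_step j k : j < n ->
  p * B j k = B j (prv k) + class_count (realized_digit j) k.
Proof.
move=> lt_jn; rewrite realized_class_count // /demand subnKC //.
exact: B_untr.
Qed.

Lemma realized_dvd j : j < n -> Q %| value p M (realized_digit j).
Proof. by move=> lt_jn; apply: (coord_div _ (B j)) => k; exact: realized_step. Qed.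

Lemma realized_coord j : j < n -> B j =1 coord (realized_digit j).
Proof.
move=> lt_jn; apply: coord_unique (realized_dvd j lt_jn) _ => k.
exact: realized_step.
Qed.

Definition part_digit i h : nat :=
  realized_digit i h - (if i is j.+1 then realized_digit j h else 0).

Lemma part_value i : value p M (realized_digit i) =
  (if i is j.+1 then value p M (realized_digit j) else 0) + value p M (part_digit i).
Proof.
case: i => [|i].
  by rewrite add0n; apply: eq_value => h; rewrite /part_digit subn0.
rewrite -value_add; apply: eq_value => h; rewrite /part_digit subnKC //.
exact: realized_digit_mono.
Qed.

Lemma realized_value_last : value p M (realized_digit n) = N.
Proof.
rewrite -[RHS](value_digit p M) //; apply: eq_value => h.
by rewrite /realized_digit ltnn.
Qed.

Lemma part_dvd i : i < n -> Q %| value p M (part_digit i).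
Proof.
move=> lt_in; have := realized_dvd i lt_in; rewrite part_value.
case: i lt_in => [|i] lt_in; first by rewrite add0n.
by rewrite dvdn_addr // realized_dvd // ltnW.
Qed.

(** The last part is positive by [B_weight]. The vector of an earlier one is [B 0] or a difference
    of consecutive vectors, hence positive. *)
Lemma part_gt0 i : i < m -> 0 < value p M (part_digit i).
Proof.
rewrite ltnS leq_eqVlt => /orP[/eqP eq_in|lt_in].
  have := realized_value_last; rewrite -eq_in part_value.
  case: i eq_in => [_|j eq_jn]; first by rewrite add0n => ->.
  have lt_jn : j < n by rewrite -eq_jn.
  by rewrite realized_value //; have := B_weight j eq_jn; lia.
have k0 := cls 0; apply: (coord_gt0_value _ k0).
have Q_part := part_dvd i lt_in.
have := realized_coord i lt_in k0.
case: i lt_in Q_part => [|i] lt_in Q_part.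
  rewrite (eq_coord (realized_digit 0) (part_digit 0)); last first.
    by move=> h _; rewrite /part_digit subn0.
  by move=> <-; exact: B_gt0.
rewrite (eq_coord _ (fun h => realized_digit i h + part_digit i.+1 h)); last first.
  by move=> h _; rewrite /part_digit subnKC // realized_digit_mono.
rewrite coord_add //; last by rewrite realized_dvd // ltnW.
rewrite -realized_coord; last exact: ltnW.
by have := B_lt i k0 lt_in; lia.
Qed.

Definition realization : m.-tuple nat :=
  [tuple value p M (part_digit i) | i < m].

Lemma nth_realization i : i < m -> nth 0 realization i = value p M (part_digit i).
Proof.
by move=> lt_im; rewrite -(tnth_nth 0 _ (Ordinal lt_im)) tnth_mktuple.
Qed.

Lemma psum_realization j : j < m -> psum realization j = value p M (realized_digit j).
Proof.
elim: j => [|j IHj] lt_jm.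
  by rewrite /psum big_ord1 nth_realization // part_value.
rewrite /psum big_ord_recr /= -/(psum realization j) IHj 1?ltnW //.
by rewrite nth_realization // -(part_value j.+1).
Qed.

Lemma part_digit_lt i h : part_digit i h < p.
Proof.
apply: leq_ltn_trans (leq_subr _ _) _; apply: leq_ltn_trans (realized_digit_le _ _) _.
by rewrite /digit ltn_pmod // ltnW.
Qed.

Lemma sum_part_digit j h : \sum_(i < j.+1) part_digit i h = realized_digit j h.
Proof.
elim: j => [|j IHj]; first by rewrite big_ord1 /part_digit subn0.
by rewrite big_ord_recr IHj /= /part_digit subnKC // realized_digit_mono.
Qed.

Lemma realization_valid : valid p s N realization.
Proof.
split; [split | |].
- by move=> i; rewrite (tnth_nth 0) nth_realization // part_gt0.
- rewrite (sum_tnth _ id) -/(psum realization n) psum_realization //.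
  exact: realized_value_last.
- move=> h; rewrite (sum_tnth _ (fun x => digit p h x)).
  have [lt_hM|le_Mh] := ltnP h M.
    rewrite (eq_bigr (fun i : 'I_m => part_digit i h)) => [|i _]; last first.
      by rewrite nth_realization // digit_value // => h'; exact: part_digit_lt.
    by rewrite sum_part_digit /realized_digit ltnn.
  have le_pow : p ^ M <= p ^ h by rewrite leq_pexp2l // ltnW.
  rewrite digit_small ?(leq_trans N_lt) // big1 // => i _.
  rewrite nth_realization // digit_small // (leq_trans _ le_pow) //.
  by apply: value_lt => h'; exact: part_digit_lt.
- move=> i; rewrite ltnS => lt_in; rewrite (tnth_nth 0) nth_realization //.
  exact: part_dvd.
Qed.

End Realization.

(** * Weights, partial sums and the conclusion *)

Lemma psumS X j : psum X j.+1 = psum X j + nth 0 X j.+1.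
Proof. exact: big_ord_recr. Qed.

(** Abel summation: entry [i], counted from 0, has coefficient [i + 1] in [wt X] and occurs in
    [n - i] of the partial sums. *)
Lemma wt_psum X : wt X + \sum_(j < n) psum X j = m * psum X n.
Proof.
have -> : wt X = \sum_(i < m) i.+1 * nth 0 X i.
  by apply: eq_bigr => i _; rewrite (tnth_nth 0).
have abel (x : nat -> nat) l : \sum_(i < l.+1) i.+1 * x i +
    \sum_(j < l) \sum_(i < j.+1) x i = l.+1 * \sum_(i < l.+1) x i.
  elim: l => [|l IHl]; first by rewrite !big_ord1 big_ord0 addn0.
  rewrite big_ord_recr [X in _ + X = _]big_ord_recr [in RHS]big_ord_recr /=.
  rewrite mulnDr [in RHS]mulSn -IHl addnAC; congr (_ + _).
  by rewrite addnA addnC.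
exact: abel.
Qed.

Lemma psum_inj X Y : (forall j, j < m -> psum X j = psum Y j) -> X = Y.
Proof.
move=> eq_psum; apply: val_inj; apply: (@eq_from_nth _ 0); rewrite !size_tuple //.
case=> [|j] lt_jm; first by have := eq_psum 0 lt_jm; rewrite /psum !big_ord1.
by have := eq_psum j.+1 lt_jm; rewrite !psumS eq_psum ?(ltnW lt_jm) // => /addnI.
Qed.

Lemma optimal_greedy : 0 < N -> (exists X, valid p s N X) ->
  exists O : m.-tuple nat,
    [/\ optimal (@valid p s m N) O,
        forall O' : m.-tuple nat, optimal (@valid p s m N) O' -> O' = O
      & greedy (@valid p s m N) O].
Proof.
move=> N_gt0 [X0 X0_valid].
have [B [greedyB nested]] : exists B : nat -> 'I_s -> nat,
    greedy_chain p s lv n U B /\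
    forall j, j.+1 < n -> forall k, demand p s (B j) k <= demand p s (B j.+1) k.
  case: (posnP n) => [->|n_gt0]; first by exists (fun _ _ => 0).
  apply: (greedy_chain_exists p s lv p_gt1 lv_sorted n U n_gt0).
  exists (coord (dsum X0 n.-1)).
  by have := valid_coord_box X0 X0_valid n.-1; rewrite prednK // => /(_ (leqnn n)).
have chainB := greedy_chain_chain p s lv n U B greedyB.
have B_box j (lt_jn : j < n) := chain_box p s lv p_gt1 n U B j chainB lt_jn.
have B_adm j (lt_jn : j < n) := (B_box j lt_jn).1.
have B_untr j (lt_jn : j < n) :=
  greedy_chain_untruncated p s lv n U B j greedyB lt_jn.
have B_gt0 j k (lt_jn : j < n) : 0 < B j k.
  by have [_ /(_ k)] := B_box j lt_jn; lia.
have B_lt j k := chain_lt p s lv p_gt1 n U B j k chainB.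
have B_nested j k (lt_jn : j.+1 < n) := nested j lt_jn k.
have weight_le X j : valid p s N X -> j < n ->
    (j.+1 < n -> forall k, coord (dsum X j) k < B j.+1 k) ->
    weight p s lv (B j) <= psum X j.
  move=> X_valid lt_jn lt_B; apply: leq_trans (valid_weight_le X X_valid j lt_jn).
  apply: (greedy_chain_best p s lv p_gt1 n U) => //.
  exact: valid_coord_box.
have B_weight j : j.+1 = n -> weight p s lv (B j) < N.
  move=> eq_jn; apply: leq_ltn_trans (weight_le X0 j X0_valid _ _) _.
  - by rewrite -eq_jn.
  - by rewrite eq_jn ltnn.
  - rewrite -(valid_psum_last X0 X0_valid) -eq_jn psumS.
    by have := valid_gt0 X0 X0_valid j.+1 ltac:(by rewrite eq_jn); lia.
pose G := realization B.
have G_valid : valid p s N G by exact: realization_valid.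
have psumG j : j < n -> psum G j = weight p s lv (B j).
  by move=> lt_jn; rewrite psum_realization ?realized_value // ltnW.
have sumG : \sum_(j < n) psum G j = \sum_(j < n) weight p s lv (B j).
  by apply: eq_bigr => j _; exact: psumG.
have G_last := valid_psum_last G G_valid.
have sum_le X : valid p s N X -> \sum_(j < n) psum G j <= \sum_(j < n) psum X j.
  move=> X_valid; rewrite sumG.
  have [le_sum _] := greedy_chain_min p s lv p_gt1 lv_sorted lv_count n U B _
    greedyB (valid_chain X X_valid).
  apply: leq_trans le_sum _; apply: leq_sum => j _.
  exact: valid_weight_le.
have wt_sum X : valid p s N X -> wt X + \sum_(j < n) psum X j = m * N.
  by move=> X_valid; rewrite wt_psum valid_psum_last.
exists G; split.
- split=> // X X_valid; have := sum_le X X_valid.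
  by have := wt_sum X X_valid; have := wt_sum G G_valid; lia.
- move=> X [X_valid X_opt]; apply: psum_inj => j; rewrite ltnS leq_eqVlt.
  case/orP=> [/eqP->|lt_jn]; first by rewrite G_last valid_psum_last.
  (* The weights of the vectors of [X] total at most its partial sums, hence at most the weights of
     [B], so [greedy_chain_min] equates them termwise. Each [psum X j] is then at least [psum G j],
     and the totals force equality. *)
  have le_sum : \sum_(j < n) psum X j <= \sum_(j < n) psum G j.
    have := X_opt G G_valid; have := wt_sum X X_valid; have := wt_sum G G_valid; lia.
  have [_ eq_weight_B] := greedy_chain_min p s lv p_gt1 lv_sorted lv_count n U B _
    greedyB (valid_chain X X_valid).
  rewrite sumG in le_sum.
  have le_weight : \sum_(j < n) weight p s lv (coord (dsum X j)) <=
      \sum_(j < n) psum X j.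
    by apply: leq_sum => i _; exact: valid_weight_le.
  have eqB := eq_weight_B (leq_trans le_weight le_sum).
  have le_psum (i : 'I_n) : weight p s lv (B i) <= psum X i.
    by rewrite -eqB //; exact: valid_weight_le.
  rewrite psumG //; apply/eqP; rewrite eqn_leq (le_psum (Ordinal lt_jn)) andbT.
  move: le_sum; rewrite (bigD1 (Ordinal lt_jn)) //=.
  rewrite [X in _ <= X](bigD1 (Ordinal lt_jn)) //=.
  have : \sum_(i < n | i != Ordinal lt_jn) weight p s lv (B i) <=
      \sum_(i < n | i != Ordinal lt_jn) psum X i by exact: leq_sum.
  move: (\sum_(i < n | _) _) (\sum_(i < n | _) psum X i); lia.
- split=> // X X_valid; apply: lexi_nth; rewrite ?size_rev ?size_tuple //.
  move=> i lt_im eq_tail.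
  rewrite !nth_rev ?size_tuple // subSS.
  (* Equal final entries make the partial sums agree from the top down. *)
  have eq_psum d : d <= i -> psum X (n - d) = psum G (n - d).
    elim: d => [|d IHd] le_di; first by rewrite subn0 G_last valid_psum_last.
    have := IHd (ltnW le_di); have := eq_tail d le_di.
    rewrite !nth_rev ?size_tuple ?subSS; [|lia|lia].
    rewrite (_ : n - d = (n - d.+1).+1); last lia.
    by rewrite !psumS => -> /addIn.
  have := eq_psum i (leqnn i); have : n - i < m by rewrite ltnS leq_subr.
  case: (n - i) => [|j] lt_jm; first by rewrite /psum !big_ord1 => ->.
  move=> eq_j; have lt_jn : j < n by [].
  suff : psum G j <= psum X j by move: eq_j; rewrite !psumS; lia.
  rewrite psumG //; apply: weight_le => // lt_j k.
  apply: leq_trans (valid_coord_lt X X_valid j k lt_j) _.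
  (* The vector of [X] at [j + 1] is [B j.+1]: both digit families stay below [p] and have the same
     value. *)
  rewrite (realized_coord B) // (eq_coord (dsum X j.+1) (realized_digit B j.+1)) //.
  have D_lt h : digit p h N < p by rewrite /digit ltn_pmod // ltnW.
  move=> h lt_hM; rewrite -[LHS](digit_value p M) // => [|h']; last first.
    exact: leq_ltn_trans (valid_dsum_le X X_valid _ _ lt_jm) (D_lt h').
  rewrite valid_value_dsum // eq_j psum_realization // digit_value // => h'.
  exact: leq_ltn_trans (realized_digit_le B _ _) (D_lt h').
Qed.

End Compositions.

End Digits.

Theorem theorem1p2 (p s : nat) (p_prime : prime p) (s_gt0 : 0 < s)
    (m N : nat) (m_gt0 : 0 < m) (N_gt0 : 0 < N) :
  (exists X : m.-tuple nat, valid p s N X) ->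
  exists O : m.-tuple nat,
    [/\ optimal (@valid p s m N) O,
        forall O' : m.-tuple nat, optimal (@valid p s m N) O' -> O' = O
      & greedy (@valid p s m N) O].
Proof.
case: m m_gt0 => // n _; have p_gt1 := prime_gt1 p_prime.
(* Since [N < p ^ N], it is enough to consider [M = N] digit positions. *)
exact: (optimal_greedy p s N p_gt1 s_gt0 n N (ltn_expl N p_gt1) N_gt0).
Qed.
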